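(* Let $n\ge 1$, let $B=(b_{ij})$ be a real $n\times n$ matrix with $b_{ij}\ge 0$ for all $i,j$ and $b_{ii}=0$, let $c\in\mathbb{R}^n$ and $X\subseteq\{0,1\}^n$. Let $\overline{X}$ satisfy $X\subseteq\overline{X}\subseteq[0,1]^n$, and for $i=1,\dots,n$ let $v_i=\max\{\sum_{j\neq i}b_{ij}x_j : x\in\overline{X},\ x_i=0\}$ and $l_i=\min\{\sum_{j\neq i}b_{ij}x_j : x\in\overline{X},\ x_i=1\}$. Consider (P): minimize $x^TBx+c^Tx$ subject to $x\in X$; (PL$_2$): minimize $\sum_{i=1}^n (y_i+c_ix_i)$ over $(x,y)\in X\times\mathbb{R}^n$ subject to $y_i\ge\sum_{j\neq i}b_{ij}x_j+v_ix_i-v_i$ and $y_i\ge l_ix_i$ for $i=1,\dots,n$; (PL$_2'$): minimize $\sum_{i=1}^n (t_i+(l_i+c_i)x_i)$ over $(x,t)\in X\times\mathbb{R}^n$ subject to $t_i\ge\sum_{j\neq i}b_{ij}x_j+(v_i-l_i)x_i-v_i$ and $t_i\ge 0$ for $i=1,\dots,n$. Then (PL$_2$) (and likewise (PL$_2'$)) and (P) are equivalent in the sense that for each optimal solution to one problem, there exists an optimal solution to the other problem having the same optimal objective value.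
   Context: $\overline{X}$ is a relaxation of $X$; it is assumed that for each $i$ the sets $\{x\in\overline{X}: x_i=0\}$ and $\{x\in\overline{X}: x_i=1\}$ are nonempty and the maxima and minima defining $v_i,l_i$ are attained. *)

(* Defs.v *)
From mathcomp Require Import all_boot all_order all_algebra.
From mathcomp Require Import boolp classical_sets reals.

Set Implicit Arguments.
Unset Strict Implicit.
Unset Printing Implicit Defensive.

Import Order.TTheory GRing.Theory Num.Theory.
Local Open Scope classical_set_scope.
Local Open Scope ring_scope.

(* Attained extrema: in particular [A] is nonempty and bounded on that side. *)
Definition is_max (R : realType) (A : set R) (m : R) : Prop :=
  A m /\ ubound A m.

Definition is_min (R : realType) (A : set R) (m : R) : Prop :=
  A m /\ lbound A m.

Record min_problem (R : realType) := MinProblem {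
  variable : Type;
  feasible : set variable;
  objective : variable -> R
}.

Arguments variable {R} m.
Arguments feasible {R} m.
Arguments objective {R} m.

Definition optimal (R : realType) (P : min_problem R) (z : variable P) : Prop :=
  feasible P z /\ forall w, feasible P w -> objective P z <= objective P w.

Arguments optimal {R} P z.

Definition equivalent_problems (R : realType) (P Q : min_problem R) : Prop :=
  (forall z : variable P, optimal P z ->
     exists w : variable Q, optimal Q w /\ objective Q w = objective P z) /\
  (forall w : variable Q, optimal Q w ->
     exists z : variable P, optimal P z /\ objective P z = objective Q w).

Definition binary_cube (R : realType) (n : nat) : set 'cV[R]_n :=
  [set x : 'cV[R]_n | forall i, x i 0 = 0 \/ x i 0 = 1].

Definition unit_cube (R : realType) (n : nat) : set 'cV[R]_n :=
  [set x : 'cV[R]_n | forall i, 0 <= x i 0 <= 1].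

Arguments binary_cube : clear implicits.
Arguments unit_cube : clear implicits.

Definition row_sum (R : realType) (n : nat) (B : 'M[R]_n) (i : 'I_n)
    (x : 'cV[R]_n) : R :=
  \sum_(j < n | j != i) B i j * x j 0.

Definition problem_P (R : realType) (n : nat) (B : 'M[R]_n) (c : 'cV[R]_n)
    (X : set 'cV[R]_n) : min_problem R :=
  {| variable := 'cV[R]_n;
     feasible := X;
     objective := fun x : 'cV[R]_n => (x^T *m B *m x + c^T *m x) 0 0 |}.

Definition problem_PL2 (R : realType) (n : nat) (B : 'M[R]_n) (c : 'cV[R]_n)
    (X : set 'cV[R]_n) (v l : 'I_n -> R) : min_problem R :=
  {| variable := ('cV[R]_n * 'cV[R]_n)%type;
     feasible := [set xy : 'cV[R]_n * 'cV[R]_n | X xy.1 /\ forall i,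
       row_sum B i xy.1 + v i * xy.1 i 0 - v i <= xy.2 i 0 /\
       l i * xy.1 i 0 <= xy.2 i 0];
     objective := fun xy : 'cV[R]_n * 'cV[R]_n =>
       \sum_(i < n) (xy.2 i 0 + c i 0 * xy.1 i 0) |}.

Definition problem_PL2' (R : realType) (n : nat) (B : 'M[R]_n) (c : 'cV[R]_n)
    (X : set 'cV[R]_n) (v l : 'I_n -> R) : min_problem R :=
  {| variable := ('cV[R]_n * 'cV[R]_n)%type;
     feasible := [set xt : 'cV[R]_n * 'cV[R]_n | X xt.1 /\ forall i,
       row_sum B i xt.1 + (v i - l i) * xt.1 i 0 - v i <= xt.2 i 0 /\
       0 <= xt.2 i 0];
     objective := fun xt : 'cV[R]_n * 'cV[R]_n =>
       \sum_(i < n) (xt.2 i 0 + (l i + c i 0) * xt.1 i 0) |}.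

(* Main.v *)
(** For binary [x] in [X], the two constraints on [y_i] in (PL2) amount to
    [row_sum B i x * x_i <= y_i]: at [x_i = 0] the definition of [v_i] makes the
    first one redundant given [0 <= y_i], and at [x_i = 1] the definition of
    [l_i] makes the second one redundant. Hence minimizing over [y] gives back
    the objective of (P). The substitution [y_i = t_i + l_i x_i] transforms
    (PL2') into (PL2). *)
Require Import Defs.
From mathcomp Require Import all_boot all_order all_algebra.
From mathcomp Require Import boolp classical_sets reals.
From mathcomp Require Import ring lra.

Set Implicit Arguments.
Unset Strict Implicit.
Unset Printing Implicit Defensive.

Import Order.TTheory GRing.Theory Num.Theory.
Local Open Scope classical_set_scope.
Local Open Scope ring_scope.

(** [p] may only lower the objective and [s] preserves it, so a feasible point of either problem is
    matched by one of the other that is no worse. This forces optimal points to be sent to optimal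
    points. *)
Lemma equivalent_problems_of_section (R : realType) (P Q : min_problem R)
    (p : variable P -> variable Q) (s : variable Q -> variable P) :
  (forall z, feasible P z -> feasible Q (p z)) ->
  (forall z, feasible P z -> objective Q (p z) <= objective P z) ->
  (forall w, feasible Q w -> feasible P (s w)) ->
  (forall w, feasible Q w -> objective P (s w) = objective Q w) ->
  equivalent_problems P Q.
Proof.
move=> p_feas p_le s_feas s_eq; split=> [z [z_feas z_min]|w [w_feas w_min]].
- have pz_feas := p_feas z z_feas.
  have eq_obj : objective Q (p z) = objective P z.
    (* A strict drop under [p] is impossible: [s (p z)] would then beat the optimal [z]. *)
    apply/eqP; rewrite eq_le p_le //= -(s_eq _ pz_feas).
    exact/z_min/s_feas.
  exists (p z); split=> //; split=> // w w_feas.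
  by rewrite eq_obj -(s_eq _ w_feas); exact/z_min/s_feas.
- exists (s w); split; last exact: s_eq.
  split=> [|z z_feas]; first exact: s_feas.
  (* Any competitor [z] is compared with [w] through its image [p z]. *)
  rewrite (s_eq _ w_feas); apply: le_trans (p_le _ z_feas).
  exact/w_min/p_feas.
Qed.

Lemma quadratic_objectiveE (R : realType) (n : nat) (B : 'M[R]_n)
    (c x : 'cV[R]_n) :
  (forall i, B i i = 0) ->
  (x^T *m B *m x + c^T *m x) 0 0 =
  \sum_(i < n) (row_sum B i x * x i 0 + c i 0 * x i 0).
Proof.
move=> B_diag; rewrite -mulmxA !mxE big_split /=.
congr (_ + _); apply: eq_bigr => i _; rewrite !mxE // mulrC; congr (_ * _).
(* The zero diagonal reconciles the full sum in [B *m x] with [row_sum], which skips [j = i]. *)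
by rewrite (bigD1 i) //= B_diag mul0r add0r.
Qed.

Section Linearization.

Variables (R : realType) (n : nat) (B : 'M[R]_n) (X Xbar : set 'cV[R]_n).
Variables (v l : 'I_n -> R).
Hypotheses (X_binary : X `<=` binary_cube R n) (X_sub_Xbar : X `<=` Xbar).
Hypothesis v_ubound : forall i, ubound [set row_sum B i x |
  x in Xbar `&` [set x : 'cV[R]_n | x i 0 = 0]] (v i).
Hypothesis l_lbound : forall i, lbound [set row_sum B i x |
  x in Xbar `&` [set x : 'cV[R]_n | x i 0 = 1]] (l i).

Lemma PL2_constraintsP (x : 'cV[R]_n) (i : 'I_n) (y : R) : X x ->
  (row_sum B i x + v i * x i 0 - v i <= y /\ l i * x i 0 <= y) <->
  row_sum B i x * x i 0 <= y.
Proof.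
move=> Xx; have [x0|x1] := X_binary Xx i.
- have sv : row_sum B i x <= v i.
    by apply: v_ubound; exists x => //; split => //; exact: X_sub_Xbar.
  by rewrite x0; split; lra.
- have ls : l i <= row_sum B i x.
    by apply: l_lbound; exists x => //; split => //; exact: X_sub_Xbar.
  by rewrite x1; split; lra.
Qed.

Lemma PL2'_constraintsP (x : 'cV[R]_n) (i : 'I_n) (t : R) : X x ->
  (row_sum B i x + (v i - l i) * x i 0 - v i <= t /\ 0 <= t) <->
  row_sum B i x * x i 0 - l i * x i 0 <= t.
Proof.
(* Taking [y = t + l i * x i 0] avoids a second case split on [x i 0]. *)
move=> Xx; have [PL2_le le_PL2] := PL2_constraintsP i (t + l i * x i 0) Xx.
by split=> [[h1 h2]|h]; [have := PL2_le _ | have := le_PL2 _]; lra.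
Qed.

Hypothesis B_diag : forall i, B i i = 0.
Variable c : 'cV[R]_n.

Lemma PL2_equivalent_P :
  equivalent_problems (problem_PL2 B c X v l) (problem_P B c X).
Proof.
(* Each [y_i] is given the least value its constraints allow, so the lift attains exactly the
   objective of (P). *)
pose s (x : 'cV[R]_n) := (x, \col_i (row_sum B i x * x i 0)).
apply: (@equivalent_problems_of_section _ (problem_PL2 B c X v l)
  (problem_P B c X) fst s) => [[x y] []|[x y] [/= Xx xyP]|x Xx|x Xx] //.
- rewrite /= quadratic_objectiveE //; apply: ler_sum => i _; rewrite lerD2r.
  exact/(PL2_constraintsP _ _ Xx).
- by split=> //= i; apply/(PL2_constraintsP _ _ Xx); rewrite mxE.
- by rewrite /= quadratic_objectiveE //; apply: eq_bigr => i _; rewrite mxE.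
Qed.

Lemma PL2'_equivalent_P :
  equivalent_problems (problem_PL2' B c X v l) (problem_P B c X).
Proof.
(* Again the least feasible value, now of [t_i]; the term [l i * x i 0] subtracted here is restored
   by the coefficient [l i + c i 0] in the objective. *)
pose s (x : 'cV[R]_n) := (x, \col_i (row_sum B i x * x i 0 - l i * x i 0)).
apply: (@equivalent_problems_of_section _ (problem_PL2' B c X v l)
  (problem_P B c X) fst s) => [[x t] []|[x t] [/= Xx xtP]|x Xx|x Xx] //.
- rewrite /= quadratic_objectiveE //; apply: ler_sum => i _.
  by have /(PL2'_constraintsP _ _ Xx) := xtP i; lra.
- by split=> //= i; apply/(PL2'_constraintsP _ _ Xx); rewrite mxE.
- by rewrite /= quadratic_objectiveE //; apply: eq_bigr => i _ /=; rewrite mxE; ring.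
Qed.

End Linearization.

Theorem theorem3 (R : realType) (n : nat) (n_ge1 : (1 <= n)%N)
    (B : 'M[R]_n) (B_ge0 : forall i j, 0 <= B i j)
    (B_diag : forall i, B i i = 0)
    (c : 'cV[R]_n) (X Xbar : set 'cV[R]_n)
    (X_binary : X `<=` binary_cube R n)
    (X_sub_Xbar : X `<=` Xbar) (Xbar_box : Xbar `<=` unit_cube R n)
    (v l : 'I_n -> R)
    (v_max : forall i,
       is_max [set row_sum B i x |
         x in Xbar `&` [set x : 'cV[R]_n | x i 0 = 0]] (v i))
    (l_min : forall i,
       is_min [set row_sum B i x |
         x in Xbar `&` [set x : 'cV[R]_n | x i 0 = 1]] (l i)) :
  equivalent_problems (problem_PL2 B c X v l) (problem_P B c X) /\
  equivalent_problems (problem_PL2' B c X v l) (problem_P B c X).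
Proof.
(* The extrema enter through the bounds they give at points of [X], which lie in [Xbar]. *)
have v_ubound i := (v_max i).2; have l_lbound i := (l_min i).2.
split; first exact: (PL2_equivalent_P X_binary X_sub_Xbar).
exact: (PL2'_equivalent_P X_binary X_sub_Xbar).
Qed.
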